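(* Let $n$ be a positive integer, and consider tuples $(p,j,k,l,m,\alpha)$ of integers with $p,j,k,l,m\ge1$, $\alpha\ge0$ and $p(j+k+l+m)=n$. Among these, let $$S_1=\{j<k,\ j<l,\ j<m,\ 0\le\alpha<n/p\},\qquad S_2=\{j=l<k\le m,\ 0\le\alpha<n/p\},$$ $$S_3=\{j=k,\ j<l,\ j<m,\ 0\le\alpha<n/p\},\qquad S_4=\{j=k=l<m,\ 0\le\alpha<n/p\},$$ $$S_5=\{j=k=l=m,\ 0\le\alpha<n/(2p)\}.$$ Then $\Sigma_A=S_1\cup S_2\cup S_3\cup S_4\cup S_5$ uniquely parametrizes the $n$-square surfaces in $\mathcal H(1,1)$ with cylinder diagram $A$: every such surface is isomorphic to the surface with parameters $v$ for exactly one $v\in\Sigma_A$.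
   Context: An $n$-square surface is a connected closed oriented surface obtained from $n$ unit axis-parallel squares by gluing right sides to left sides and top sides to bottom sides by translations; two are isomorphic if there is a bijection of their squares respecting right-neighbours and top-neighbours. It is in $\mathcal H(1,1)$ if it has exactly two cone points, each of angle $4\pi$. The surface with parameters $(p,j,k,l,m,\alpha)$: take the horizontal cylinder of circumference $w=j+k+l+m$ and height $p$ (the rectangle $[0,w]\times[0,p]$ with vertical sides identified). Divide the bottom boundary, starting at $x=0$ and going right, into consecutive segments of lengths $j,k,l,m$ named $s_j,s_k,s_l,s_m$ in this order; divide the top boundary, starting at $x=\alpha$ (mod $w$) and going right, into consecutive segments $s_j,s_m,s_l,s_k$ in this order with the same lengths. Glue the top and bottom segments of the same name by translation. An $n$-square surface has cylinder diagram $A$ if it is isomorphic to a surface obtained this way (i.e. it has one horizontal cylinder with four horizontal saddle connections glued in this pattern). *)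

(* Defs.v *)
From mathcomp Require Import all_boot all_fingroup.
From mathcomp Require Import zify.

Set Implicit Arguments.
Unset Strict Implicit.
Unset Printing Implicit Defensive.

(* A gluing of finitely many unit squares by translations: the right side of
   s is glued to the left side of [rnbr s], and the top side of s to the
   bottom side of [tnbr s].  The resulting surface is automatically closed
   and oriented, but need not be connected. *)
Record gluing := Gluing {
  square : finType;
  rnbr : {perm square};
  tnbr : {perm square}
}.

Definition adjacent (X : gluing) : rel (square X) :=
  [rel s t | [|| t == rnbr X s, s == rnbr X t, t == tnbr X s | s == tnbr X t]].

(* For n > 0, the surface is connected iff any two squares are joined by a
   chain of squares sharing sides. *)
Definition square_surface (n : nat) (X : gluing) : Prop :=
  #|square X| = n /\ forall s t : square X, connect (@adjacent X) s t.

Definition isomorphic (X Y : gluing) : Prop :=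
  exists f : square X -> square Y,
    [/\ bijective f,
        forall s, f (rnbr X s) = rnbr Y (f s)
      & forall s, f (tnbr X s) = tnbr Y (f s)].

(* (s, (e, u)) is the corner of s on its right side if e, on its left side
   otherwise, and on its top side if u, on its bottom side otherwise. *)
Definition corner (X : gluing) : finType := (square X * (bool * bool))%type.

(* The next corner met when turning counterclockwise around a vertex. *)
Definition turn (X : gluing) (c : corner X) : corner X :=
  let: (s, d) := c in
  match d with
  | (false, false) => ((rnbr X)^-1%g s, (true, false))
  | (true, false) => ((tnbr X)^-1%g s, (true, true))
  | (true, true) => (rnbr X s, (false, true))
  | (false, true) => (tnbr X s, (false, false))
  end.

(* A vertex of the surface is the set of the corners around it; each of them
   contributes an angle of pi/2, so the angle at V is #|V| * pi/2. *)
Definition vertices (X : gluing) : {set {set corner X}} :=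
  [set [set d | fconnect (@turn X) c d] | c : corner X].

(* Angle different from 2 * pi. *)
Definition cone_points (X : gluing) : {set {set corner X}} :=
  [set V in vertices X | #|V| != 4].

(* Two cone points, each of angle 4 * pi = 8 * (pi/2). *)
Definition in_H11 (X : gluing) : Prop :=
  #|cone_points X| = 2 /\ forall V, V \in cone_points X -> #|V| = 8.

Record params := Params {
  hgt : nat;    (* p *)
  len_j : nat;
  len_k : nat;
  len_l : nat;
  len_m : nat;
  twist : nat   (* alpha *)
}.

Definition circ (v : params) : nat := len_j v + len_k v + len_l v + len_m v.

(* The position x - alpha (mod w) along the top boundary, counted from the
   left end of the top copy of s_j. *)
Definition top_pos (v : params) (x : nat) : nat :=
  (x + (circ v - twist v %% circ v)) %% circ v.

(* Starting at top_pos 0, the top segments are s_j, s_m, s_l, s_k; starting at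
   abscissa 0, the bottom segments are s_j, s_k, s_l, s_m.  The unit segment
   [x, x+1] of the top is glued to the bottom one [cross v x, cross v x + 1],
   which has the same name and the same offset. *)
Definition cross (v : params) (x : nat) : nat :=
  let: Params _ j k l m _ := v in
  let t := top_pos v x in
  if t < j then t
  else if t < j + m then (j + k + l) + (t - j)
  else if t < j + m + l then (j + k) + (t - (j + m))
  else j + (t - (j + m + l)).

Lemma top_pos_lt (v : params) (x : 'I_(circ v)) : top_pos v x < circ v.
Proof. by rewrite ltn_pmod // (leq_ltn_trans (leq0n x)). Qed.

Lemma top_pos_inj (v : params) (x y : 'I_(circ v)) :
  top_pos v x = top_pos v y -> x = y.
Proof.
move/eqP; rewrite eqn_modDr !modn_small // => /eqP exy.
exact: val_inj.
Qed.

Lemma cross_lt (v : params) (x : 'I_(circ v)) : cross v x < circ v.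
Proof.
have := top_pos_lt x; move: (nat_of_ord x) => {}x; rewrite /cross.
case: v => p j k l m a; move: (top_pos _ _) => t.
rewrite /circ /=; do ![case: ifP => ?]; lia.
Qed.

Definition cross_ord (v : params) (x : 'I_(circ v)) : 'I_(circ v) :=
  Ordinal (cross_lt x).

Lemma cross_ord_inj (v : params) : injective (@cross_ord v).
Proof.
move=> x y /(congr1 val) /= exy; apply: top_pos_inj.
move: (top_pos_lt x) (top_pos_lt y) exy.
move: (nat_of_ord x) (nat_of_ord y) => {}x {}y; rewrite /cross.
case: v => p j k l m a; move: (top_pos _ x) (top_pos _ y) => s t.
rewrite /circ /=; do ![case: ifP => ?]; lia.
Qed.

(* The square (x, y) is [x, x+1] * [y, y+1] in the cylinder
   (R / wZ) * [0, p]; [ordS] is the cyclic successor. *)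
Definition param_rnbr (v : params) (s : 'I_(circ v) * 'I_(hgt v)) :
    'I_(circ v) * 'I_(hgt v) :=
  (ordS s.1, s.2).

Definition param_tnbr (v : params) (s : 'I_(circ v) * 'I_(hgt v)) :
    'I_(circ v) * 'I_(hgt v) :=
  (if (val s.2).+1 < hgt v then s.1 else cross_ord s.1, ordS s.2).

Lemma param_rnbr_inj (v : params) : injective (@param_rnbr v).
Proof.
by move=> [x y] [x' y'] /pair_equal_spec [/= /(can_inj (@ordSK _)) -> ->].
Qed.

Lemma param_tnbr_inj (v : params) : injective (@param_tnbr v).
Proof.
move=> [x y] [x' y'] /pair_equal_spec [/= ex].
move/(can_inj (@ordSK _)) => ey; subst y'.
by move: ex; case: ifP => // _ => [-> //|/cross_ord_inj ->].
Qed.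

Definition param_surface (v : params) : gluing :=
  Gluing (perm (@param_rnbr_inj v)) (perm (@param_tnbr_inj v)).

Definition positive (v : params) : bool :=
  [&& 1 <= hgt v, 1 <= len_j v, 1 <= len_k v, 1 <= len_l v & 1 <= len_m v].

Definition diagram_A (X : gluing) : Prop :=
  exists v : params, positive v /\ isomorphic X (param_surface v).

Definition admissible (n : nat) (v : params) : bool :=
  positive v && (hgt v * circ v == n).

(* In the five conditions below the quotients are exact for admissible v:
   n = p * w and, in [S5], n = 2 * p * (2 * j). *)
Definition S1 (n : nat) (v : params) : bool :=
  let: Params p j k l m a := v in
  [&& j < k, j < l, j < m & a < n %/ p].

Definition S2 (n : nat) (v : params) : bool :=
  let: Params p j k l m a := v in
  [&& j == l, l < k, k <= m & a < n %/ p].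

Definition S3 (n : nat) (v : params) : bool :=
  let: Params p j k l m a := v in
  [&& j == k, j < l, j < m & a < n %/ p].

Definition S4 (n : nat) (v : params) : bool :=
  let: Params p j k l m a := v in
  [&& j == k, k == l, l < m & a < n %/ p].

Definition S5 (n : nat) (v : params) : bool :=
  let: Params p j k l m a := v in
  [&& j == k, k == l, l == m & a < n %/ (2 * p)].

Definition Sigma_A (n : nat) : pred params :=
  [pred v | admissible n v && [|| S1 n v, S2 n v, S3 n v, S4 n v | S5 n v]].

(* Main.v *)
Require Import Defs.
From mathcomp Require Import all_boot all_fingroup.
From mathcomp Require Import zify.

(* The commutator of "right" and "top" turns once around the lower left corner
   of a square.  On the surface of parameters v it fixes every square except the
   four whose lower left corner is an end of a bottom segment, which it permutes
   by two disjoint transpositions: these are the two cone points of angle 4 pi.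
   An isomorphism commutes with the commutator, so up to the four cyclic
   relabellings (j,k,l,m,alpha) -> (k,l,m,j,alpha+l+m) of the segments it
   preserves the origin of the cylinder, hence all coordinates, hence the four
   cone squares and the gluing, that is, all the parameters.  Finally Sigma_A is
   a fundamental domain for these relabellings; the second relabelling fixes the
   tuples with j = l and k = m, and the first one shifts alpha by w/2 when the
   four lengths agree, whence the bound n/(2p) in S5. *)

Set Implicit Arguments.
Unset Strict Implicit.
Unset Printing Implicit Defensive.

(** * Isomorphism as an equivalence relation *)

Lemma isomorphic_refl X : isomorphic X X.
Proof. by exists id; split=> //; exists id. Qed.

Lemma isomorphic_sym X Y : isomorphic X Y -> isomorphic Y X.
Proof.
case=> f [[g fK gK] fR fT]; exists g; split; first by exists f.
  by move=> s; apply: (can_inj fK); rewrite gK fR gK.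
by move=> s; apply: (can_inj fK); rewrite gK fT gK.
Qed.

Lemma isomorphic_trans Y X Z :
  isomorphic X Y -> isomorphic Y Z -> isomorphic X Z.
Proof.
case=> f [bf fR fT] [g [bg gR gT]]; exists (g \o f).
by split; [exact: bij_comp | move=> s /=; rewrite fR gR
  | move=> s /=; rewrite fT gT].
Qed.

Lemma isomorphic_card X Y : isomorphic X Y -> #|square X| = #|square Y|.
Proof. by case=> f [bf _ _]; apply: bij_eq_card bf. Qed.

(** * Vertices and cone angles read off the commutator *)

Section Vertices.
Variable X : gluing.
Implicit Types s t : square X.
Local Notation R := (rnbr X).
Local Notation T := (tnbr X).

(* One full turn around the lower left corner of a square. *)
Definition monodromy : {perm square X} := (R^-1 * T^-1 * R * T)%g.

Lemma monodromyE s : monodromy (R (T s)) = T (R s).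
Proof. by rewrite /monodromy !permM !permK. Qed.

(** With [monodromyE], this form of a square cancels the inverses in the commutator, so they never
    have to be computed. *)
Lemma monodromyP s : exists t, s = R (T t).
Proof. by exists (T^-1 (R^-1 s))%g; rewrite !permKV. Qed.

(** Successive values of [turn] from the lower left corner of [s]; the next value is the lower left
    corner of [monodromy s]. *)
Definition quarter_turns s : seq (corner X) :=
  [:: (s, (false, false)); (R^-1%g s, (true, false));
      (T^-1%g (R^-1%g s), (true, true));
      (R (T^-1%g (R^-1%g s)), (false, true))].

Lemma mem_quarter_turns (c : corner X) : exists s, c \in quarter_turns s.
Proof.
case: c => s [[] []].
- by exists (R (T s)); rewrite !inE !permK eqxx !orbT.
- by exists (R s); rewrite !inE !permK eqxx !orbT.
- by exists (R (T (R^-1%g s))); rewrite !inE !permK permKV eqxx !orbT.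
- by exists s; rewrite !inE eqxx.
Qed.

Lemma uniq_quarter_turns s t :
  s != t -> uniq (quarter_turns s ++ quarter_turns t).
Proof.
move=> st; rewrite /= !inE !xpair_eqE /= !(inj_eq perm_inj) (negPf st).
by rewrite ?andbF ?andbT.
Qed.

Lemma path_quarter_turns s p :
  fpath (@turn X) (s, (false, false))
    (behead (quarter_turns s) ++ (monodromy s, (false, false)) :: p) =
  fpath (@turn X) (monodromy s, (false, false)) p.
Proof. by rewrite /= !eqxx /monodromy !permM eqxx. Qed.

(** The two cases keep the list of corners free of repetitions, so that its length gives the
    angle. *)
Definition star s : {set corner X} :=
  [set c in if monodromy s == s then quarter_turns s
            else quarter_turns s ++ quarter_turns (monodromy s)].

Lemma card_star s : #|star s| = if monodromy s == s then 4 else 8.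
Proof.
rewrite cardsE; case: ifP => [_|/negbT]; last rewrite eq_sym => neq.
  apply/(card_uniqP (s := quarter_turns s)).
  by rewrite /= !inE !xpair_eqE !andbF.
exact/(card_uniqP (s := _ ++ _))/uniq_quarter_turns.
Qed.

Hypothesis monodromyK : involutive monodromy.

(** Since the commutator is an involution, the orbit of [turn] closes up after one or two full
    turns. *)
Lemma star_orbit s (c : corner X) :
  c \in quarter_turns s -> [set d | fconnect (@turn X) c d] = star s.
Proof.
move=> cs; apply/setP=> d; rewrite !inE.
case: ifP => [/eqP fs | _].
  apply: fconnect_cycle cs d; have := path_quarter_turns s [::].
  by rewrite fs.
apply: fconnect_cycle; last by rewrite mem_cat cs.
have := path_quarter_turns s
  (behead (quarter_turns (monodromy s)) ++ [:: (s, (false, false))]).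
have := path_quarter_turns (monodromy s) [::].
by rewrite monodromyK => ->.
Qed.

Lemma verticesE : vertices X = [set star s | s : square X].
Proof.
apply/setP=> V; apply/imsetP/imsetP=> -[c _ ->].
  by have [s cs] := mem_quarter_turns c; exists s; rewrite ?(star_orbit cs).
by exists (c, (false, false)); rewrite // (@star_orbit c) ?mem_head.
Qed.

Lemma mem_star s t : ((t, (false, false)) \in star s) =
  (t == s) || (t == monodromy s).
Proof.
rewrite inE; case: ifP => [/eqP ->|_]; rewrite !inE !xpair_eqE /= ?andbF ?andbT.
  by rewrite ?orbF orbb.
by rewrite ?orbF.
Qed.

Lemma star_monodromy s : star (monodromy s) = star s.
Proof.
apply/setP=> c; rewrite !in_set monodromyK eq_sym.
by case: ifP => [/eqP-> //|_]; rewrite !mem_cat orbC.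
Qed.

(** Vertices correspond to the cycles of the commutator, and those of angle other than 2 pi to its
    transpositions; [s] and [t] represent two transpositions that exhaust the moved squares. *)
Lemma in_H11_of_monodromy s t :
  monodromy s != s -> monodromy t != t -> t != s -> t != monodromy s ->
  (forall u, monodromy u != u ->
     [|| u == s, u == monodromy s, u == t | u == monodromy t]) ->
  in_H11 X.
Proof.
move=> ms mt ts tms moved.
have cE : cone_points X = [set star s; star t].
  apply/setP=> V; rewrite !inE verticesE; apply/andP/orP.
    case=> /imsetP[u _ ->]; rewrite card_star; case: ifP => // /negbT /moved.
    case/or4P=> /eqP->; rewrite ?star_monodromy eqxx; by [left | right].
  case=> /eqP->; rewrite card_star (negPf ms, negPf mt).
    by split=> //; apply: imset_f.
  by split=> //; apply: imset_f.
have neq : star s != star t.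
  apply: contraNneq ts => e.
  by have := mem_star s t; rewrite e mem_star eqxx (negPf tms) orbF => <-.
split=> [|V]; first by rewrite cE cards2 neq.
by rewrite cE !inE => /orP[] /eqP->; rewrite card_star (negPf ms, negPf mt).
Qed.

End Vertices.

Lemma isomorphism_monodromy X Y (f : square X -> square Y) :
  (forall s, f (rnbr X s) = rnbr Y (f s)) ->
  (forall s, f (tnbr X s) = tnbr Y (f s)) ->
  forall s, f (monodromy X s) = monodromy Y (f s).
Proof.
move=> fR fT s; have [t ->] := monodromyP s.
by rewrite monodromyE fR !fT !fR monodromyE.
Qed.

(** * The commutator on a parametrized surface *)

Lemma succ_modn t w : t < w -> t.+1 %% w = if t.+1 < w then t.+1 else 0.
Proof.
by rewrite leq_eqVlt => /predU1P[<-|tw]; rewrite ?ltnn ?modnn ?tw ?modn_small.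
Qed.

Lemma rnbr_param v s : rnbr (param_surface v) s = (ordS s.1, s.2).
Proof. by rewrite permE. Qed.

Lemma tnbr_param v s : tnbr (param_surface v) s =
  (if (val s.2).+1 < hgt v then s.1 else cross_ord s.1, ordS s.2).
Proof. by rewrite permE. Qed.

Lemma card_param v : #|square (param_surface v)| = hgt v * circ v.
Proof. by rewrite card_prod !card_ord mulnC. Qed.

Lemma circ_gt0 v : positive v -> 0 < circ v.
Proof. by case: v => p j k l m a; rewrite /positive /circ /=; lia. Qed.

Lemma hgt_gt0 v : positive v -> 0 < hgt v.
Proof. by case/and5P. Qed.

(** Left ends of the bottom segments. *)
Definition singular (v : params) : pred nat :=
  [pred x | [|| x == 0, x == len_j v, x == len_j v + len_k v
              | x == len_j v + len_k v + len_l v]].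

(** Exchanges the left ends of s_j and s_l, and those of s_k and s_m. *)
Definition switch (v : params) (x : nat) : nat :=
  if x == 0 then len_j v + len_k v
  else if x == len_j v then len_j v + len_k v + len_l v
  else if x == len_j v + len_k v then 0
  else if x == len_j v + len_k v + len_l v then len_j v else x.

Lemma switchK v : positive v -> involutive (switch v).
Proof.
case: v => p j k l m a; rewrite /positive /= => pos x.
rewrite [switch _ x]/switch /=.
by do 4?[case: ifP => ?]; rewrite /switch /=; do 4?[case: ifP => ?]; lia.
Qed.

Lemma switch_neq v x : positive v -> (switch v x != x) = (x \in singular v).
Proof.
case: v => p j k l m a; rewrite /positive /switch inE /= => pos.
by do !case: ifP => ?; lia.
Qed.

Lemma top_pos_succ v x :
  top_pos v (x.+1 %% circ v) = (top_pos v x).+1 %% circ v.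
Proof. by rewrite /top_pos modnDml -[in RHS]addn1 modnDml addn1 addSn. Qed.

(** Inside a segment, top and bottom agree. Past the end of s_j comes s_k at the bottom but s_m at
    the top, and past the end of s_k comes s_l at the bottom but s_j at the top; the other two ends
    are alike, and [switch] corrects each. *)
Lemma cross_succ v x : positive v -> x < circ v ->
  cross v (x.+1 %% circ v) = switch v ((cross v x).+1 %% circ v).
Proof.
move=> pos xw; have := cross_lt (Ordinal xw); have := top_pos_lt (Ordinal xw).
move: (top_pos_succ v x); rewrite /= => tE tw cw.
rewrite (succ_modn cw); move: tE cw; rewrite (succ_modn tw).
move: (x.+1 %% _) tw => y {xw}; case: v pos => p j k l m a.
rewrite /positive /cross; move: (top_pos _ x) (top_pos _ y) => t t'.
rewrite /circ /= => pos tw ->.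
by case: (ltnP t j) => ?; last case: (ltnP t (j + m)) => ?;
  last case: (ltnP t (j + m + l)) => ?; case: (ltnP t.+1) => ? /= cw;
  do 4?[case: ifP => ?]; rewrite /switch /=; do 4?[case: ifP => ?]; lia.
Qed.

(** Right then up and up then right differ only when the upward step crosses the top of the
    cylinder, that is, lands in row 0. *)
Lemma monodromy_param v s : positive v ->
  val (monodromy (param_surface v) s).1 =
    (if val s.2 == 0 then switch v (val s.1) else val s.1)
  /\ (monodromy (param_surface v) s).2 = s.2.
Proof.
move=> pos; have [[x y] ->] := monodromyP s; rewrite monodromyE.
rewrite !(rnbr_param, tnbr_param) /= (succ_modn (ltn_ord y)).
by case: ifP => _; rewrite //= cross_succ.
Qed.

Lemma monodromy_param_neq v s : positive v ->
  (monodromy (param_surface v) s != s) =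
  (val s.2 == 0) && (val s.1 \in singular v).
Proof.
move=> pos; have [m1 m2] := monodromy_param s pos.
rewrite -switch_neq // -pair_eqE /= m2 eqxx andbT -val_eqE /= m1.
by case: ifP; rewrite ?eqxx.
Qed.

Lemma param_eq v (s t : square (param_surface v)) :
  val s.1 = val t.1 -> val s.2 = val t.2 -> s = t.
Proof. by case: s t => [x y] [x' y'] /= /val_inj-> /val_inj->. Qed.

Lemma monodromy_paramK v :
  positive v -> involutive (monodromy (param_surface v)).
Proof.
move=> pos s; have [m1 m2] := monodromy_param s pos.
have [m3 m4] := monodromy_param (monodromy (param_surface v) s) pos.
apply: param_eq; last by rewrite m4 m2.
by rewrite m3 m2 m1; case: (_ == 0); first exact: switchK.
Qed.

(** * Coordinates from the origin, connectedness and cone points *)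

Lemma iter_rnbr_param v (s : square (param_surface v)) i :
  iter i (rnbr (param_surface v)) s = (iter i (@ordS _) s.1, s.2).
Proof. by elim: i => [|i IH]; [case: s | rewrite iterS IH rnbr_param]. Qed.

Lemma val_iter_ordS n (x : 'I_n) i : val (iter i (@ordS n) x) = (x + i) %% n.
Proof.
elim: i => [|i IH] /=; first by rewrite addn0 modn_small.
by rewrite [nat_of_ord _]IH -addn1 modnDml addn1 addnS.
Qed.

Lemma iter_tnbr_param v (s : square (param_surface v)) i :
  val s.2 + i < hgt v ->
  iter i (tnbr (param_surface v)) s = (s.1, iter i (@ordS _) s.2).
Proof.
elim: i => [|i IH] h; first by case: s h.
rewrite addnS in h; rewrite iterS IH ?tnbr_param; last exact: ltnW.
by rewrite [val _]val_iter_ordS modn_small ?h // ltnW.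
Qed.

Lemma adjacent_sym X : symmetric (@adjacent X).
Proof. move=> s t; rewrite /adjacent /=.
by case: (t == rnbr X s); case: (s == rnbr X t); rewrite // !orFb orbC. Qed.

Lemma connect_rnbr X (s : square X) i :
  connect (@adjacent X) s (iter i (rnbr X) s).
Proof.
elim: i => //= i IH; apply: connect_trans IH (connect1 _).
by rewrite /adjacent /= eqxx.
Qed.

Lemma connect_tnbr X (s : square X) i :
  connect (@adjacent X) s (iter i (tnbr X) s).
Proof.
elim: i => //= i IH; apply: connect_trans IH (connect1 _).
by rewrite /adjacent /= eqxx !orbT.
Qed.

Definition origin v (pos : positive v) : square (param_surface v) :=
  (Ordinal (circ_gt0 pos), Ordinal (hgt_gt0 pos)).

(** The coordinates of a square count moves from the origin. This gives connectedness, and lets an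
    isomorphism be computed from the image of the origin. *)
Lemma originE v (pos : positive v) (s : square (param_surface v)) :
  s = iter (val s.2) (tnbr (param_surface v))
        (iter (val s.1) (rnbr (param_surface v)) (origin pos)).
Proof.
rewrite iter_rnbr_param iter_tnbr_param //=; last exact: ltn_ord.
by apply: param_eq; rewrite /= val_iter_ordS add0n modn_small.
Qed.

Lemma square_surface_param v :
  positive v -> square_surface (hgt v * circ v) (param_surface v).
Proof.
move=> pos; split=> [|s t]; first exact: card_param.
have c0 u : connect (@adjacent (param_surface v)) (origin pos) u.
  rewrite (originE pos u).
  exact: connect_trans (connect_rnbr _ _) (connect_tnbr _ _).
apply: connect_trans (c0 t).
by rewrite (sym_connect_sym (@adjacent_sym _)).
Qed.

Lemma in_H11_param v : positive v -> in_H11 (param_surface v).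
Proof.
move=> pos; have jw : len_j v < circ v.
  by move: pos; case: (v) => p j k l m a; rewrite /positive /circ /=; lia.
(* The left ends of s_j and s_k provide one square from each of the two transpositions. *)
pose s := origin pos.
pose t : square (param_surface v) := (Ordinal jw, Ordinal (hgt_gt0 pos)).
have [s1 s2] := monodromy_param s pos; have [t1 t2] := monodromy_param t pos.
have [p1 p2 p3 p4 p5] := and5P pos.
apply: (@in_H11_of_monodromy _ (monodromy_paramK pos) s t).
- by rewrite monodromy_param_neq.
- by rewrite monodromy_param_neq //= inE eqxx orbT.
- by rewrite -pair_eqE /= -val_eqE /=; lia.
- rewrite -pair_eqE /= -!val_eqE /= s1 /switch /=; lia.
move=> u; rewrite monodromy_param_neq // !inE => /andP[/eqP u2 h].
suff: [|| val u.1 == 0, val u.1 == switch v 0, val u.1 == len_j v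
        | val u.1 == switch v (len_j v)].
  move: s1 t1; rewrite /= => s1 t1.
  rewrite -s1 -t1; case/or4P=> /eqP e; apply/or4P;
  [apply: Or41 | apply: Or42 | apply: Or43 | apply: Or44];
  by apply/eqP/param_eq; rewrite ?e ?s2 ?t2.
have -> : switch v (len_j v) = len_j v + len_k v + len_l v.
  by rewrite /switch eqxx; case: eqP => //; lia.
by rewrite /switch /=; case/or4P: h => ->; rewrite ?orbT.
Qed.

(** * Isomorphisms with a marked square, and rotations of the cylinder *)

Definition carries X Y (s : square X) (t : square Y) : Prop :=
  exists f : square X -> square Y,
    [/\ bijective f, forall u, f (rnbr X u) = rnbr Y (f u),
        forall u, f (tnbr X u) = tnbr Y (f u) & f s = t].

Lemma carries_trans Y X Z (t : square Y) (s : square X) (u : square Z) :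
  carries s t -> carries t u -> carries s u.
Proof.
case=> f [bf fR fT <-] [g [bg gR gT <-]]; exists (g \o f).
by split; [exact: bij_comp | move=> r /=; rewrite fR gR
  | move=> r /=; rewrite fT gT |].
Qed.

Lemma carries_isomorphic X Y (s : square X) (t : square Y) :
  carries s t -> isomorphic X Y.
Proof. by case=> f [? ? ? _]; exists f. Qed.

(** Rotation of the cylinder by [d] commutes with every move inside the cylinder, so only its
    compatibility with [cross] has to be required of the gluing. *)
Lemma shift_carries v v' d : positive v -> hgt v' = hgt v ->
  circ v' = circ v ->
  (forall x, x < circ v ->
     cross v' ((x + d) %% circ v) = (cross v x + d) %% circ v) ->
  forall s : square (param_surface v), exists t : square (param_surface v'),
    [/\ val t.1 = (val s.1 + d) %% circ v, val t.2 = val s.2 & carries s t].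
Proof.
move=> pos eh ec crossD s; have w_gt0 := circ_gt0 pos.
pose f (u : square (param_surface v)) : square (param_surface v') :=
  (cast_ord (esym ec) (Ordinal (ltn_pmod (u.1 + d) w_gt0)),
   cast_ord (esym eh) u.2).
exists (f s); split=> //; exists f; split=> //.
- apply: inj_card_bij; last by rewrite !card_param eh ec.
  move=> u u' e; have := congr1 (fun z => val z.2) e.
  have := congr1 (fun z => val z.1) e => /= /eqP.
  by rewrite eqn_modDr !modn_small // => /eqP e1 e2; apply: param_eq.
- move=> u; rewrite !rnbr_param; apply: param_eq => //=.
  by rewrite ec modnDml -[in RHS]addn1 modnDml addn1 addSn.
move=> u; rewrite !tnbr_param; apply: param_eq => /=; last by rewrite eh.
by rewrite eh; case: ifP => //= _; rewrite crossD.
Qed.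

(** * Cyclic relabelling of the segments *)

Lemma add_modn x d w :
  x < w -> d <= w -> (x + d) %% w = if x + d < w then x + d else x + d - w.
Proof.
move=> xw dw; case: ltnP => [/modn_small //|h].
by rewrite -{1}(subnK h) modnDr modn_small //; lia.
Qed.

Lemma top_posE v x : x < circ v -> twist v < circ v ->
  top_pos v x = if twist v <= x then x - twist v else x + circ v - twist v.
Proof.
move=> xw aw; rewrite /top_pos (modn_small aw) add_modn ?leq_subr //.
by do 2?case: ifP => ?; lia.
Qed.

(* The gluing pattern is invariant under a cyclic relabelling of the four
   segments; moving the origin to the left end of the bottom copy of s_k turns
   the position alpha + j + m + l of the top copy of s_k into alpha + m + l. *)
Definition relabel (v : params) : params :=
  let: Params p j k l m a := v in
  Params p k l m j (if a < j + k then a + l + m else a - (j + k)).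

Lemma positive_relabel v : positive (relabel v) = positive v.
Proof. by case: v => p j k l m a; rewrite /positive /=; lia. Qed.

Lemma hgt_relabel v : hgt (relabel v) = hgt v.
Proof. by case: v. Qed.

Lemma circ_relabel v : circ (relabel v) = circ v.
Proof. by case: v => p j k l m a; rewrite /circ /=; lia. Qed.

Lemma twist_relabel v :
  twist v < circ v -> twist (relabel v) < circ (relabel v).
Proof. by case: v => p j k l m a; rewrite /circ /=; case: ifP; lia. Qed.

(** Adding [circ v - len_j v] subtracts [len_j v] modulo the circumference. The top order j, m, l, k
    read from s_k is k, j, m, l, which is again the pattern j, m, l, k in the new names. *)
Lemma cross_relabel v x : positive v -> twist v < circ v -> x < circ v ->
  cross (relabel v) ((x + (circ v - len_j v)) %% circ v) =
  (cross v x + (circ v - len_j v)) %% circ v.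
Proof.
move=> pos aw xw; have cw := cross_lt (Ordinal xw).
have w_gt0 := circ_gt0 pos.
have yw := ltn_pmod (x + (circ v - len_j v)) w_gt0.
have aw' := twist_relabel aw.
rewrite (add_modn cw) ?leq_subr //; move: cw; rewrite /= /cross.
rewrite top_posE // -/(relabel v).
have := top_posE _ aw'; rewrite circ_relabel => /(_ _ yw).
rewrite (add_modn xw) ?leq_subr //.
case: v pos aw xw {w_gt0 yw aw'} => p j k l m a; rewrite /circ /positive /=.
move=> pos aw xw; move: (top_pos _ _) => t' t'E.
(* The top copy of s_k fills the last [k] units of the old top order, so counting from its left end
   adds [k] modulo the circumference. *)
have {t'E} -> : t' =
    let t := if a <= x then x - a else x + (j + k + l + m) - a in
    if t + k < j + k + l + m then t + k else t + k - (j + k + l + m).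
  rewrite t'E /=; case: (ltnP a) => ?; case: (leqP a x) => ?;
    case: (ltnP (x + _)) => ? /=; do 3?[case: ifP => ?]; lia.
have tw : (if a <= x then x - a else x + (j + k + l + m) - a) < j + k + l + m.
  by case: ifP; lia.
move: (if a <= x then _ else _) tw => t tw /=.
by case: (ltnP t j) => ?; last case: (ltnP t (j + m)) => ?;
  last case: (ltnP t (j + m + l)) => ?; case: (ltnP (t + k)) => ? /= cw;
  do 5?[case: ifP => ?]; lia.
Qed.

Lemma relabel_carries v (s : square (param_surface v)) :
  positive v -> twist v < circ v -> len_j v <= val s.1 ->
  exists t : square (param_surface (relabel v)),
    [/\ val t.1 = val s.1 - len_j v, val t.2 = val s.2 & carries s t].
Proof.
move=> pos aw js.
have [t [t1 t2 st]] := shift_carries pos (hgt_relabel v) (circ_relabel v)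
  (fun x => cross_relabel pos aw) s.
exists t; split=> //; rewrite t1 (add_modn (ltn_ord s.1)) ?leq_subr //.
have jw : len_j v < circ v.
  by move: pos; case: (v) => p j k l m a; rewrite /positive /circ /=; lia.
by move: js => /=; case: ifP; lia.
Qed.

Lemma isomorphic_relabel v : positive v -> twist v < circ v ->
  isomorphic (param_surface v) (param_surface (relabel v)).
Proof.
move=> pos aw; have [t [_ _ /carries_isomorphic//]] := shift_carries pos
  (hgt_relabel v) (circ_relabel v) (fun x => cross_relabel pos aw)
  (origin pos).
Qed.

(** [top_pos] sees the twist only modulo the circumference, while [cross_relabel] assumes it
    reduced. *)
Definition reduce_twist (v : params) : params :=
  let: Params p j k l m a := v in Params p j k l m (a %% circ v).

Lemma isomorphic_reduce_twist v : positive v ->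
  isomorphic (param_surface v) (param_surface (reduce_twist v)).
Proof.
move=> pos; have eh : hgt (reduce_twist v) = hgt v by case: (v).
have ec : circ (reduce_twist v) = circ v by case: (v).
have [|t [_ _ /carries_isomorphic//]] :=
  shift_carries (d := 0) pos eh ec _ (origin pos).
move=> x xw; have cw := cross_lt (Ordinal xw); rewrite !addn0 !modn_small //.
by move: ec; case: (v) => p j k l m a /=; rewrite /top_pos => -> /=;
  rewrite modn_mod.
Qed.

Lemma iter_relabel v i : positive v -> twist v < circ v ->
  [/\ positive (iter i relabel v), hgt (iter i relabel v) = hgt v,
      circ (iter i relabel v) = circ v
    & twist (iter i relabel v) < circ (iter i relabel v)].
Proof.
move=> pos aw; elim: i => //= i [IH1 IH2 IH3 IH4].
by rewrite positive_relabel hgt_relabel twist_relabel // circ_relabel.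
Qed.

Lemma isomorphic_iter_relabel v i : positive v -> twist v < circ v ->
  isomorphic (param_surface v) (param_surface (iter i relabel v)).
Proof.
move=> pos aw; elim: i => [|i IH]; first exact: isomorphic_refl.
have [pos' _ _ aw'] := iter_relabel i pos aw.
exact: isomorphic_trans IH (isomorphic_relabel pos' aw').
Qed.

Lemma iter_relabel_carries v i (s : square (param_surface v)) :
  positive v -> twist v < circ v ->
  \sum_(h < i) len_j (iter h relabel v) <= val s.1 ->
  exists t : square (param_surface (iter i relabel v)),
    [/\ val t.1 = val s.1 - \sum_(h < i) len_j (iter h relabel v),
        val t.2 = val s.2 & carries s t].
Proof.
move=> pos aw; elim: i => [|i IH].
  by exists s; rewrite big_ord0 subn0; split=> //; exists id; split=> //;
    exists id.
rewrite big_ord_recr /= => le_s.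
have [t [t1 t2 st]] := IH (leq_trans (leq_addr _ _) le_s).
have [pos' _ _ aw'] := iter_relabel i pos aw.
have [|u [u1 u2 tu]] := relabel_carries (s := t) pos' aw'.
  by rewrite t1 leq_subRL // (leq_trans (leq_addr _ _) le_s).
by exists u; rewrite u1 t1 u2 t2 subnDA; split=> //; apply: carries_trans tu.
Qed.

(** Each relabelling moves the origin past the current first segment, and the singular abscissas are
    the partial sums of these lengths. *)
Lemma carries_origin v (s : square (param_surface v)) :
  positive v -> twist v < circ v -> val s.1 \in singular v ->
  exists2 i, i < 4 &
    exists t : square (param_surface (iter i relabel v)),
      [/\ val t.1 = 0, val t.2 = val s.2 & carries s t].
Proof.
move=> pos aw sing.
have [i i4 si] : exists2 i, i < 4 &
    val s.1 = \sum_(h < i) len_j (iter h relabel v).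
  move: sing; rewrite inE; move: (val s.1) => x /or4P[] /eqP->;
  [exists 0 | exists 1 | exists 2 | exists 3] => //;
  by rewrite !(big_ord_recr, big_ord0) //=; case: (v).
exists i => //.
have [|t [t1 t2 st]] := iter_relabel_carries (i := i) (s := s) pos aw.
  by rewrite si.
by exists t; rewrite t1 si subnn.
Qed.

(** * Recovering the parameters from the surface *)

(** The row of the origin closes up after [circ v] moves to the right, hence so does its image. *)
Lemma circ_dvd v v' : positive v ->
  isomorphic (param_surface v) (param_surface v') -> circ v' %| circ v.
Proof.
move=> pos [f [_ fR _]]; pose s := origin pos.
have fiter i : f (iter i (rnbr _) s) = iter i (rnbr _) (f s).
  by elim: i => //= i IH; rewrite fR IH.
have := fiter (circ v); rewrite !iter_rnbr_param.
have -> : (iter (circ v) (@ordS _) s.1, s.2) = s.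
  by apply: param_eq; rewrite //= val_iter_ordS modnDr modn_small.
move/(congr1 (fun t => val t.1)); rewrite /= val_iter_ordS => /eqP.
rewrite -{1}(modn_small (ltn_ord (f s).1)) -{1}[val _]addn0.
by rewrite eqn_modDl mod0n eq_sym.
Qed.

Lemma isomorphic_circ v v' : positive v -> positive v' ->
  isomorphic (param_surface v) (param_surface v') -> circ v = circ v'.
Proof.
move=> pos pos' iso; apply/eqP; rewrite eqn_dvd.
rewrite (circ_dvd pos' (isomorphic_sym iso)).
exact: circ_dvd iso.
Qed.

Lemma carries_origin_inj v v' (s : square (param_surface v))
    (t : square (param_surface v')) :
  positive v -> positive v' -> twist v < circ v -> twist v' < circ v' ->
  hgt v = hgt v' -> circ v = circ v' -> carries s t ->
  val s.1 = 0 -> val s.2 = 0 -> val t.1 = 0 -> val t.2 = 0 -> v = v'.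
Proof.
move=> pos pos' aw aw' eh ec [f [bf fR fT fs]] s1 s2 t1 t2.
have fE u : val (f u).1 = val u.1 /\ val (f u).2 = val u.2.
  have -> : u = iter (val u.2) (tnbr _) (iter (val u.1) (rnbr _) s).
    rewrite [LHS](originE pos); congr (iter _ _ (iter _ _ _)).
    by apply: param_eq.
  have fiterR i : f (iter i (rnbr _) s) = iter i (rnbr _) t.
    by elim: i => //= i IH; rewrite fR IH.
  have fiterT i r : f (iter i (tnbr _) r) = iter i (tnbr _) (f r).
    by elim: i => //= i IH; rewrite fT IH.
  rewrite fiterT fiterR !iter_rnbr_param !iter_tnbr_param;
    [| by rewrite s2 ltn_ord | by rewrite t2 -eh ltn_ord] => /=.
  by rewrite !val_iter_ordS s1 t1 s2 t2; split; congr (_ %% _).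
have sing x : x < circ v -> (x \in singular v) = (x \in singular v').
  move=> xw; pose u : square (param_surface v) := (Ordinal xw, s.2).
  have := monodromy_param_neq u pos; have := monodromy_param_neq (f u) pos'.
  have [-> ->] := fE u; rewrite /= s2 eqxx /= => <- <-.
  by rewrite -(isomorphism_monodromy fR fT) (inj_eq (bij_inj bf)).
(* Going up from column 0 of the top row reads off [cross] at 0 on both surfaces. *)
have crossE : cross v 0 = cross v' 0.
  have hp : (hgt v).-1 < hgt v by rewrite prednK // hgt_gt0.
  pose u : square (param_surface v) := (s.1, Ordinal hp).
  have := fE (tnbr _ u); rewrite fT !tnbr_param => -[+ _] /=.
  have [u1 u2] := fE u; rewrite u2 /= prednK ?hgt_gt0 //.
  have -> : (hgt v < hgt v') = false by rewrite -eh ltnn.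
  rewrite ltnn /= => crossE.
  by rewrite u1 /= s1 in crossE.
move: crossE sing eh; rewrite /cross !top_posE ?circ_gt0 // -ec.
case: v v' pos pos' aw aw' ec {s t f bf fR fT fs s1 s2 t1 t2 fE}
  => p j k l m a [p' j' k' l' m' a']; rewrite /positive /circ /=.
move=> pos pos' aw aw' ec crossE sing ->.
have {sing} [sing sing'] : (forall x, x < j + k + l + m ->
     [|| x == 0, x == j, x == j + k | x == j + k + l] ->
     [|| x == 0, x == j', x == j' + k' | x == j' + k' + l']) /\
  (forall x, x < j + k + l + m ->
     [|| x == 0, x == j', x == j' + k' | x == j' + k' + l'] ->
     [|| x == 0, x == j, x == j + k | x == j + k + l]).
  by split=> x /sing; rewrite !inE /= => ->.
(* The least nonzero singular abscissas, [j] and [j'], must coincide; the next two lengths follow in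
   the same way. *)
have ej : j' = j.
  have := sing j; have := sing' j'; rewrite !eqxx !orbT.
  by move: pos pos' ec; clear; lia.
subst j'; have ek : k' = k.
  have := sing (j + k); have := sing' (j + k'); rewrite !eqxx !orbT.
  by move: pos pos' ec; clear; lia.
subst k'; have el : l' = l.
  have := sing (j + k + l); have := sing' (j + k + l'); rewrite !eqxx !orbT.
  by move: pos pos' ec; clear; lia.
subst l'; have em : m' = m by move: ec; clear; lia.
subst m'; suff -> : a = a' by [].
(* Once the lengths agree, the value of [cross] at 0 determines the top position of 0, which is 0 if
   the twist is 0 and the circumference minus the twist otherwise. *)
clear sing sing' pos' ec.
by move: crossE; case: (leqP a 0) => ?; case: (leqP a' 0) => ?;
  do 6?[case: ifP => ?]; lia.
Qed.

(** * A fundamental domain for relabelling *)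

(** The least length occurs once, at two opposite places, at two neighbouring places, or at three or
    four places of the cyclic order. The bound [k <= m] breaks the tie left by the half rotation;
    the last disjunct merges the lengths of [S4] and [S5]. *)
Definition least_first (v : params) : bool :=
  let: Params p j k l m a := v in
  [|| [&& j < k, j < l & j < m], [&& j == l, l < k & k <= m],
      [&& j == k, j < l & j < m] | [&& j == k, k == l & l <= m]].

Lemma least_first_relabel v : exists i, least_first (iter i relabel v).
Proof.
pose least v := let: Params p j k l m a := v in [&& j <= k, j <= l & j <= m].
have least_relabel : exists i, least (iter i relabel v).
  case: v => p j k l m a.
  have : [|| [&& j <= k, j <= l & j <= m], [&& k <= l, k <= m & k <= j],
    [&& l <= m, l <= j & l <= k] | [&& m <= j, m <= k & m <= l]] by lia.
  by case/or4P; [exists 0 | exists 1 | exists 2 | exists 3].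
case: least_relabel => i.
suff H u : least u -> exists i, least_first (iter i relabel u).
  by case/H=> i' lf; exists (i' + i); rewrite iterD.
case: u => p j k l m a /= /and3P[].
case: (ltngtP j k) => // ? _; case: (ltngtP j l) => // ? _;
  case: (ltngtP j m) => // ? _; case: (leqP k m) => ?;
  (* Three relabellings bring s_m to the front when a run of minima starts there; two do so for s_l,
     or exchange [k] and [m] when the minima are opposite. *)
  first [by exists 0 => /=; lia | by exists 2 => /=; lia
        | by exists 3 => /=; lia].
Qed.

(* When the four lengths agree, relabelling only shifts the twist by half the
   circumference. *)
Definition reduced (v : params) : bool :=
  let: Params p j k l m a := v in
  least_first v &&
  if [&& j == k, k == l & l == m] then a < 2 * j else a < circ v.

(** For admissible tuples n/p is the circumference w, and n/(2p) is w/2, equal to 2j when the four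
    lengths agree. *)
Lemma Sigma_AE n v : admissible n v -> (v \in Sigma_A n) = reduced v.
Proof.
move=> adm; rewrite inE adm; case: v adm => p j k l m a.
rewrite /admissible /positive /= => /andP[/and5P[p0 _ _ _ _] /eqP <-].
rewrite /S1 /S2 /S3 /S4 /S5 mulKn //.
have -> : (a < p * circ (Params p j k l m a) %/ (2 * p)) =
    (a < circ (Params p j k l m a) %/ 2) by rewrite [2 * p]mulnC divnMl.
rewrite /circ /=; case: ifP => e; lia.
Qed.

Lemma reduced_twist v : reduced v -> twist v < circ v.
Proof.
by case: v => p j k l m a; rewrite /reduced /circ /=; case: ifP; lia.
Qed.

Lemma reduced_relabel v :
  positive v -> twist v < circ v -> exists i, reduced (iter i relabel v).
Proof.
move=> pos aw; have [i lf] := least_first_relabel v.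
have [_ _ _] := iter_relabel i pos aw.
have [vi|nvi] := boolP (reduced (iter i relabel v)); first by exists i.
move: nvi lf; case E : (iter i relabel v) => [p j k l m a].
rewrite /reduced => + lf aw'; rewrite lf aw' /=; case: ifP => //.
case/and3P=> /eqP jk /eqP kl /eqP lm; subst k l m; rewrite -leqNgt => a_ge.
(* The twist is at least [2 * j], and one more relabelling of equal lengths subtracts [2 * j] from
   it. *)
exists i.+1; rewrite iterS E /= !eqxx leqnn !ltnn /=.
by move: aw'; rewrite /circ /=; case: ifP; lia.
Qed.

(** For equal lengths an odd number of relabellings pushes the twist out of the allowed half, and an
    even number fixes the tuple. Otherwise one or three relabellings break the inequalities of
    [least_first]. *)
Lemma reduced_inj v i :
  i < 4 -> positive v -> reduced v -> reduced (iter i relabel v) ->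
  iter i relabel v = v.
Proof.
case: v => p j k l m a i4 pos.
have [/and3P[/eqP jk /eqP kl /eqP lm]|ne] := boolP [&& j == k, k == l & l == m].
  subst k l m; rewrite /reduced /= !eqxx leqnn !ltnn /= => aj.
  have e1 : relabel (Params p j j j j a) = Params p j j j j (a + j + j).
    by rewrite /= ifT //; lia.
  have e2 : relabel (Params p j j j j (a + j + j)) = Params p j j j j a.
    by rewrite /= ifF; [congr Params|]; lia.
  case: i i4 => [|[|[|[|]]]] // _; rewrite /iter ?e1 ?e2 ?e1 //= !eqxx /=; lia.
rewrite {1}/reduced (negPf ne) => /andP[lf aw] redi.
have {redi} : least_first (iter i relabel (Params p j k l m a)).
  by move: redi; rewrite /reduced; case: (iter _ _ _) => ? ? ? ? ? ? /andP[].
move: pos lf aw; rewrite /positive /circ /=.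
case: i i4 => [|[|[|[|]]]] //= _ pos lf aw lf'; try by exfalso; lia.
(* Two relabellings exchange [j] with [l] and [k] with [m]; only opposite minima survive this, and
   then [k <= m] and [m <= k] both hold. *)
have [jl km] : j = l /\ k = m by lia.
subst l m; congr Params.
by case: (ltnP a) => ?; case: ifP => ?; lia.
Qed.

Theorem proposition3p4 (n : nat) (n_gt0 : 0 < n) :
  (forall v : params, v \in Sigma_A n ->
     [/\ square_surface n (param_surface v),
         in_H11 (param_surface v)
       & diagram_A (param_surface v)])
  /\
  (forall X : gluing, square_surface n X -> in_H11 X -> diagram_A X ->
     exists! v : params, v \in Sigma_A n /\ isomorphic X (param_surface v)).
Proof.
split=> [v /andP[/andP[pos /eqP <-] _]|X [cX _] _ [v0 [pos0 iso0]]].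
  split; [exact: square_surface_param | exact: in_H11_param |].
  by exists v; split; last exact: isomorphic_refl.
have n0 : hgt v0 * circ v0 = n by rewrite -cX (isomorphic_card iso0) card_param.
pose v1 := reduce_twist v0.
have pos1 : positive v1 by rewrite /v1; case: (v0) pos0.
have n1 : hgt v1 * circ v1 = n by rewrite -n0 /v1; case: (v0).
have aw1 : twist v1 < circ v1.
  by have := circ_gt0 pos0; rewrite /v1; case: (v0) => p j k l m a;
    apply: ltn_pmod.
have iso1 : isomorphic X (param_surface v1).
  exact: isomorphic_trans iso0 (isomorphic_reduce_twist pos0).
have [i red] := reduced_relabel pos1 aw1.
have [pos hE cE _] := iter_relabel i pos1 aw1.
have iso : isomorphic X (param_surface (iter i relabel v1)).
  exact: isomorphic_trans iso1 (isomorphic_iter_relabel i pos1 aw1).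
have adm : admissible n (iter i relabel v1).
  by rewrite /admissible pos hE cE n1 eqxx.
exists (iter i relabel v1); split; first by rewrite Sigma_AE.
move: (iter i relabel v1) pos red iso adm => v pos red iso adm.
move=> {pos1 n1 aw1 iso1 v1 hE cE} v' [v'S iso'].
have adm' : admissible n v' by case/andP: v'S.
rewrite Sigma_AE // in v'S.
have /andP[pos' /eqP n'] := adm'; have /andP[_ /eqP nv] := adm.
have aw := reduced_twist red; have aw' := reduced_twist v'S.
have isov := isomorphic_trans (isomorphic_sym iso) iso'.
have ec := isomorphic_circ pos pos' isov.
(* Both surfaces have [n] squares, so equal circumferences force equal heights. *)
have eh : hgt v = hgt v'.
  by apply/eqP; rewrite -(eqn_pmul2r (circ_gt0 pos)) nv ec n'.
have [f [bf fR fT]] := isov; pose s := origin pos.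
(* The commutator moves the origin, hence also its image, which therefore lies in the bottom row at
   a singular abscissa. *)
have : monodromy (param_surface v') (f s) != f s.
  rewrite -(isomorphism_monodromy fR fT) (inj_eq (bij_inj bf)).
  by rewrite monodromy_param_neq.
rewrite monodromy_param_neq // => /andP[/eqP f2 sing].
have [k k4 [t [t1 t2 ft]]] := carries_origin pos' aw' sing.
have [posk hk ck ak] := iter_relabel k pos' aw'.
have st : carries s t by apply: carries_trans ft; exists f.
have vE : v = iter k relabel v'.
  by apply: (carries_origin_inj pos posk aw ak _ _ st) => //;
    rewrite ?hk ?ck ?t2.
(* Both [v'] and its relabelling are reduced, hence equal. *)
by rewrite vE in red *; apply: reduced_inj.
Qed.
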